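(* Let $d\ge 2$, let $\mathbb{F}_q$ be a finite field of odd characteristic, let $S_j=\{x\in\mathbb{F}_q^d : Q(x)=j\}$ with $j\in\mathbb{F}_q^*$ and $Q$ a non-degenerate quadratic form over $\mathbb{F}_q$, and let $E\subset S_j$. Then for every $p_0\ge 2$: (i) $\|\widehat{E d\sigma}\|_{L^r(\mathbb{F}_q^d,dm)}\lesssim \|E\|_{L^p(S_j,d\sigma)}$ for $1\lesssim \#E\lesssim q^{\frac{d-1}{2}}$, whenever \[p\ge \frac{(6d-2)p_0-8d+8}{(3d-5)p_0-4d+12}\quad\text{and}\quad r\ge \frac{(6d-2)p_0-8d+8}{(3d-3)p_0-4d+4};\] (ii) $\|\widehat{E d\sigma}\|_{L^r(\mathbb{F}_q^d,dm)}\lesssim \|E\|_{L^p(S_j,d\sigma)}$ for $1\lesssim \#E\lesssim q^{\frac{d+1}{2}}$, whenever \[p\ge \frac{(6d-10)p_0-8d+24}{(3d-9)p_0-4d+20}\quad\text{and}\quad r\ge \frac{(6d-10)p_0-8d+24}{(3d-7)p_0-4d+12}.\]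
   Context: $\chi$ is a fixed non-trivial additive character of $\mathbb{F}_q$. A quadratic form $Q(x)=\sum_{i,k=1}^d a_{ik}x_ix_k$ with $a_{ik}=a_{ki}\in\mathbb{F}_q$ is non-degenerate if the matrix $(a_{ik})$ is invertible. $E$ also denotes the indicator function of $E$. For $f:S_j\to\mathbb{C}$, $\widehat{fd\sigma}(m)=\frac{1}{\#S_j}\sum_{x\in S_j}\chi(-x\cdot m)f(x)$, and $\widehat{Ed\sigma}$ is this with $f=E$. Norms: $\|g\|_{L^r(\mathbb{F}_q^d,dm)}=\big(\sum_{m\in\mathbb{F}_q^d}|g(m)|^r\big)^{1/r}$, $\|f\|_{L^p(S_j,d\sigma)}=\big(\frac{1}{\#S_j}\sum_{x\in S_j}|f(x)|^p\big)^{1/p}$. $X\lesssim Y$ means $X\le CY$ for a constant $C$ independent of $q$ (and of $E$); size conditions like $1\lesssim\#E\lesssim q^{a}$ mean $c_1\le\#E\le c_2q^{a}$ for fixed constants $c_1,c_2>0$, the implied constant in the conclusion being allowed to depend on them.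
   Formalization: In (ii) both denominators (3d-9)p_0-4d+20 and (3d-7)p_0-4d+12 are assumed positive, which only excludes d=2 with p_0≥4, where the thresholds are undefined (p_0=4) or negative and the claim fails (e.g. p=r=1, E=S_j). *)

(* Defs.v *)
From HB Require Import structures.
From mathcomp Require Import all_boot all_order all_algebra all_field.
From mathcomp Require Import complex.
From mathcomp Require Import reals exp.
Set Implicit Arguments. Unset Strict Implicit. Unset Printing Implicit Defensive.
Import Order.TTheory GRing.Theory Num.Theory.
Local Open Scope ring_scope.

Section Defs.
Variable R : realType.
Variable F : finFieldType.
Variable d : nat.

Definition quad_form (A : 'M[F]_d) (x : 'rV[F]_d) : F :=
  \sum_(i < d) \sum_(k < d) A i k * x 0 i * x 0 k.

Definition qsphere (A : 'M[F]_d) (j : F) : {set 'rV[F]_d} :=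
  [set x : 'rV[F]_d | quad_form A x == j].

Definition dotv (x m : 'rV[F]_d) : F := \sum_(i < d) x 0 i * m 0 i.

Definition nontriv_add_char (chi : F -> R[i]) : Prop :=
  [/\ chi 0 = 1, (forall a b, chi (a + b) = chi a * chi b) & exists a, chi a != 1].

Definition ext_hat (chi : F -> R[i]) (S : {set 'rV[F]_d})
    (f : 'rV[F]_d -> R[i]) (m : 'rV[F]_d) : R[i] :=
  (#|S|%:R)^-1 * \sum_(x in S) chi (- dotv x m) * f x.

Definition indC (E : {set 'rV[F]_d}) (x : 'rV[F]_d) : R[i] := (x \in E)%:R.
Definition indR (E : {set 'rV[F]_d}) (x : 'rV[F]_d) : R := (x \in E)%:R.

Definition norm_Lr_dm (g : 'rV[F]_d -> R[i]) (r : R) : R :=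
  (\sum_(m : 'rV[F]_d) (Normc.normc (g m)) `^ r) `^ (r^-1).

Definition norm_Lp_dsigma (S : {set 'rV[F]_d}) (f : 'rV[F]_d -> R) (p : R) : R :=
  ((#|S|%:R)^-1 * \sum_(x in S) `|f x| `^ p) `^ (p^-1).

End Defs.

Arguments indC {R F d} E x.
Arguments indR {R F d} E x.

(* Main.v *)
Require Import Defs.
From HB Require Import structures.
From mathcomp Require Import all_boot all_order all_algebra all_field.
From mathcomp Require Import complex.
From mathcomp Require Import reals exp.
From mathcomp Require Import ring lra zify.
Set Implicit Arguments. Unset Strict Implicit. Unset Printing Implicit Defensive.
Import Order.TTheory GRing.Theory Num.Theory.
Import Normc.
Local Open Scope ring_scope.

(** Let [n], [q] and [s] be the sizes of [E], of the field and of the sphere, so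
    that [s] is of order [q ^ (d - 1)], and let [a m] be the modulus of the
    unnormalised exponential sum of [E] at [m].  The estimate for the exponents
    [p] and [r] amounts to bounding the [r]-th moment of [a] by a multiple of
    [n ^ (r / p) * s ^ (r - r / p)].  One has [a m <= n], the second moment of [a]
    is [q ^ d * n] and its fourth moment is [q ^ d] times the additive energy
    of [E].

    For (i), the bound [a ^ r <= n ^ (r - 2) * a ^ 2] already gives the exact
    exponents.  For (ii) the energy is needed: [x + y = z + w] on the sphere forces
    [x - z] to be orthogonal to [y - z].  For a fixed [z] these pairs of chords are
    counted by bilinear character sums, which are completed to sums over the whole
    space.  Completion loses nothing for the chords not tangent at [z], because
    their multiples are pairwise distinct, nor for the tangent ones, because
    translating those along [z] does not affect orthogonality to each other.  Hence
    the energy is at most a multiple of [n ^ 3 / q + q ^ ((d - 1) / 2) * n ^ 2], and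
    interpolating between the second and the fourth moment gives the exact
    exponents when [3 <= d].  In the plane a chord determines the chords orthogonal
    to it, so that the energy is at most [3 * n ^ 2], and
    [a ^ r <= n ^ (r - 4) * a ^ 4] suffices. *)

Section Normc.
Variable R : rcfType.
Implicit Type x : R[i].

Lemma normc_ge0 x : 0 <= normc x.
Proof. exact: (@normr_ge0 R (Rcomplex R) x). Qed.

Lemma normc_complex x : (normc x)%:C%C = `|x|.
Proof. by []. Qed.

Lemma normc_nat k : normc (k%:R : R[i]) = k%:R.
Proof. by apply: (@complexI R); rewrite rmorph_nat; exact: (normr_nat R[i]). Qed.

Lemma le_normc_sum (I : Type) (s : seq I) (P : pred I) (f : I -> R[i]) :
  normc (\sum_(i <- s | P i) f i) <= \sum_(i <- s | P i) normc (f i).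
Proof. exact: (@ler_norm_sum R (Rcomplex R) I s f P). Qed.

End Normc.

Lemma big_setX (R : Type) (idx : R) (op : Monoid.com_law idx) (I J : finType)
    (X : {set I}) (Y : {set J}) (f : I -> J -> R) :
  \big[op/idx]_(p in setX X Y) f p.1 p.2
    = \big[op/idx]_(x in X) \big[op/idx]_(y in Y) f x y.
Proof. by rewrite pair_big; apply: eq_bigl => p; rewrite inE. Qed.

Lemma sqr_sum_le_card (R : realFieldType) (I : finType) (D : {set I}) (a : I -> R) :
  (\sum_(i in D) a i) ^+ 2 <= #|D|%:R * \sum_(i in D) a i ^+ 2.
Proof.
have [->|D_neq0] := eqVneq D set0; first by rewrite !big_set0 expr2 !mulr0.
set n := #|D|%:R; set s := \sum_(i in D) a i; set s2 := \sum_(i in D) a i ^+ 2.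
have n_gt0 : 0 < n by rewrite ltr0n card_gt0.
have variance : \sum_(i in D) (n * a i - s) ^+ 2 = n * (n * s2 - s ^+ 2).
  transitivity (\sum_(i in D) (n ^+ 2 * a i ^+ 2 + (- (2 * n * s) * a i + s ^+ 2))).
    by apply: eq_bigr => i _; ring.
  rewrite big_split big_split /= sumr_const -[s ^+ 2 *+ _]mulr_natr -!mulr_sumr.
  by rewrite -/s -/s2 -/n; ring.
rewrite -subr_ge0 -(pmulr_rge0 _ n_gt0) -variance.
by apply: sumr_ge0 => i _; exact: sqr_ge0.
Qed.

Section Collisions.
Variables (I T : finType) (f : I -> T).
Implicit Type W : {set I}.

Definition collisions W : {set I * I} := [set p in setX W W | f p.1 == f p.2].

Lemma card_collisions_inj W : {in W &, injective f} -> #|collisions W| = #|W|.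
Proof.
move=> f_inj; have -> : collisions W = [set (x, x) | x in W].
  apply/setP => -[x y]; rewrite !inE /=; apply/idP/imsetP.
    by case/andP => /andP[xW yW] /eqP/(f_inj _ _ xW yW) <-; exists x.
  by case=> w wW [-> ->]; rewrite wW eqxx.
by rewrite card_imset // => x y [].
Qed.

End Collisions.

(** * Bilinear forms *)

Section MatrixForm.
Variables (F : fieldType) (d : nat) (A : 'M[F]_d).
Implicit Types u v w z : 'rV[F]_d.
Local Notation "''[' u , v ]" := (form idfun A u v).

Lemma form_idfunE u v : '[u, v] = (u *m A *m v^T) 0 0.
Proof. by rewrite /form map_mx_id. Qed.

Lemma form_nondegenerate v : A \in unitmx -> v != 0 -> exists u, '[u, v] != 0.
Proof.
move=> Aunit v_neq0; have /matrix0Pn[i [k]] : A *m v^T != 0.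
  by apply: contraNneq v_neq0 => Av0; rewrite -trmx_eq0 -(mulKmx Aunit v^T) Av0 mulmx0.
by rewrite ord1 => Avi; exists (delta_mx 0 i); rewrite form_idfunE -mulmxA -rowE mxE.
Qed.

Lemma plane_orthogonal_collinear u v w : d = 2%N -> A \in unitmx ->
  u != 0 -> v != 0 -> '[v, u] = 0 -> '[w, u] = 0 -> exists t, w = t *: v.
Proof.
move=> d_eq2 Aunit u_neq0 v_neq0 vu wu; pose K := kermx (A *m u^T).
have in_K x : '[x, u] = 0 -> (x <= K)%MS.
  move=> xu; apply/sub_kermxP/matrixP => i k.
  by rewrite !ord1 mulmxA -form_idfunE xu mxE.
have rank_Au : \rank (A *m u^T) = 1%N.
  apply/eqP; rewrite eqn_leq rank_leq_col lt0n mxrank_eq0 /=.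
  have [y] := form_nondegenerate Aunit u_neq0; rewrite form_idfunE -mulmxA.
  by apply: contraNneq => ->; rewrite mulmx0 mxE.
have rank_K : \rank K = 1%N by rewrite mxrank_ker rank_Au d_eq2.
have vK : (v == K)%MS.
  by rewrite -(mxrank_leqif_eq (in_K v vu)) rank_K rank_rV v_neq0.
by have := in_K w wu; rewrite -(eqmxP vK) => /sub_rVP.
Qed.

Hypothesis Asym : A^T = A.

Lemma form_symmetric u v : '[u, v] = '[v, u].
Proof.
rewrite !form_idfunE; have -> : v *m A *m u^T = (u *m A *m v^T)^T.
  by rewrite !trmx_mul trmxK Asym mulmxA.
by rewrite [RHS]mxE.
Qed.

Lemma form_sqrDZ u z t :
  '[u + t *: z, u + t *: z] = '[u, u] + 2 * '[u, z] * t + '[z, z] * t ^+ 2.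
Proof. by rewrite !formDl !formDr !formZl !formZr (form_symmetric z) /=; ring. Qed.

Lemma form_sqrD u v : '[u + v, u + v] = '[u, u] + 2 * '[u, v] + '[v, v].
Proof. by rewrite -{1 2}[v]scale1r form_sqrDZ; ring. Qed.

End MatrixForm.

Section QuadraticForm.
Variables (F : finFieldType) (d : nat) (A : 'M[F]_d).
Implicit Type x : 'rV[F]_d.
Local Notation "''[' u , v ]" := (form idfun A u v).

Lemma quad_formE x : quad_form A x = '[x, x].
Proof.
rewrite form_idfunE /quad_form mxE exchange_big; apply: eq_bigr => k _.
by rewrite !mxE big_distrl; apply: eq_bigr => i _ /=; rewrite (mulrC (A i k)).
Qed.

Lemma mem_qsphere j x : (x \in qsphere A j) = ('[x, x] == j).
Proof. by rewrite inE quad_formE. Qed.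

End QuadraticForm.

(** * Character sums *)

Section AdditiveCharacters.
Variables (R : realType) (F : finFieldType) (chi : F -> R[i]).
Hypothesis chiP : nontriv_add_char chi.

Lemma add_char0 : chi 0 = 1.
Proof. by case: chiP. Qed.

Lemma add_charD a b : chi (a + b) = chi a * chi b.
Proof. by case: chiP. Qed.

Lemma normc_add_char a : normc (chi a) = 1.
Proof.
have [p p_prime pF] := finPcharP F.
have normc_chiMn n : normc (chi (a *+ n)) = normc (chi a) ^+ n.
  elim: n => [|n IHn]; first by rewrite mulr0n expr0 add_char0 normc1.
  by rewrite mulrS add_charD normcM IHn exprS.
have := normc_chiMn p; rewrite mulrn_pchar // add_char0 normc1 => /esym/eqP.
by rewrite pexpr_eq1 ?prime_gt0 ?normc_ge0 // => /eqP.
Qed.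

Lemma conjc_add_char a : conjc (chi a) = chi (- a).
Proof.
have chi_conj : chi a * conjc (chi a) = 1.
  by rewrite -sqr_normc -normc_complex normc_add_char expr1n.
have chi_neq0 : chi a != 0.
  by apply: contra_eq_neq chi_conj => ->; rewrite mul0r eq_sym oner_neq0.
by apply: (mulfI chi_neq0); rewrite chi_conj -add_charD subrr add_char0.
Qed.

Lemma add_char_mul_neq1 a : a != 0 -> exists b, chi (b * a) != 1.
Proof.
by move=> a_neq0; have [_ _ [c chi_c]] := chiP; exists (c / a); rewrite divfK.
Qed.

Lemma sum_add_char_eq0 (V : finZmodType) (L : V -> F) w :
  {morph L : v v' / v + v'} -> chi (L w) != 1 -> \sum_v chi (L v) = 0.
Proof.
move=> LD chi_w.
have shift : \sum_v chi (L v) = chi (L w) * \sum_v chi (L v).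
  rewrite [LHS](reindex_inj (addIr w)) mulr_sumr.
  by apply: eq_bigr => v _; rewrite LD add_charD mulrC.
apply: contra_neq_eq chi_w => sum_neq0.
by apply: (mulIf sum_neq0); rewrite mul1r.
Qed.

Lemma sum_add_charM a : \sum_t chi (t * a) = if a == 0 then #|F|%:R else 0.
Proof.
have [->|a_neq0] := eqVneq.
  by under eq_bigr do rewrite mulr0 add_char0; rewrite sumr_const.
have [b chi_b] := add_char_mul_neq1 a_neq0.
by apply: (sum_add_char_eq0 (L := *%R^~ a)) chi_b => s t; rewrite mulrDl.
Qed.

Lemma card_zeros_le (I : finType) (D : {set I}) (h : I -> F) :
  (#|F| * #|[set i in D | h i == 0]|)%:R
    <= #|D|%:R + \sum_(t | t != 0) normc (\sum_(i in D) chi (t * h i)).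
Proof.
have count : (#|F| * #|[set i in D | h i == 0]|)%:R
    = \sum_t \sum_(i in D) chi (t * h i).
  rewrite exchange_big (eq_bigr _ (fun i _ => sum_add_charM (h i))).
  rewrite -big_mkcondr sumr_const.
  by rewrite -mulrnA (eq_card (B := [set i in D | h i == 0])) // => i; rewrite inE.
rewrite -(normc_nat R) count (bigD1 0) //=.
apply: le_trans (le_normcD _ _) (lerD _ (le_normc_sum _ _ _)).
under eq_bigr do rewrite mul0r add_char0.
by rewrite sumr_const normc_nat.
Qed.

End AdditiveCharacters.

Section OrthogonalPairs.
Variables (F : finFieldType) (d : nat) (A : 'M[F]_d).
Implicit Types X Y : {set 'rV[F]_d}.
Local Notation "''[' u , v ]" := (form idfun A u v).

Definition ortho_pairs X Y : {set 'rV[F]_d * 'rV[F]_d} :=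
  [set p in setX X Y | '[p.1, p.2] == 0].

Lemma card_ortho_pairsC X Y : A^T = A -> #|ortho_pairs X Y| = #|ortho_pairs Y X|.
Proof.
move=> Asym; pose swap (p : 'rV[F]_d * 'rV[F]_d) := (p.2, p.1).
have swap_inj : injective swap by move=> [u v] [u' v'] [-> ->].
rewrite -(card_preimset _ swap_inj); apply: eq_card => p; rewrite !inE /=.
by rewrite form_symmetric // [X in X && _]andbC.
Qed.

Lemma card_ortho_pairsID X Y (P : pred 'rV[F]_d) :
  #|ortho_pairs X Y|
    = (#|ortho_pairs [set u in X | P u] Y| + #|ortho_pairs [set u in X | ~~ P u] Y|)%N.
Proof.
rewrite -(cardsID [set p | P p.1]); congr addn; apply: eq_card => p; rewrite !inE.
  by rewrite andbC andbA andbA [P _ && _]andbC.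
by rewrite !andbA [~~ _ && _]andbC.
Qed.

Definition distinct_directions X : Prop :=
  {in setX [set~ 0] X &, injective (fun p : F * 'rV[F]_d => p.1 *: p.2)}.

End OrthogonalPairs.

Section CharacterSums.
Variables (R : realType) (F : finFieldType) (d : nat) (A : 'M[F]_d) (chi : F -> R[i]).
Hypotheses (Aunit : A \in unitmx) (chiP : nontriv_add_char chi).
Implicit Types X Y : {set 'rV[F]_d}.
Local Notation "''[' u , v ]" := (form idfun A u v).
Local Notation q := #|F|.

Lemma sum_add_char_form w :
  \sum_v chi '[v, w] = if w == 0 then (q ^ d)%:R else 0.
Proof.
have [->|w_neq0] := eqVneq.
  under eq_bigr do rewrite form0r (add_char0 chiP).
  by rewrite sumr_const card_mx mul1n.
have [u uw_neq0] := form_nondegenerate Aunit w_neq0.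
have [b chi_b] := add_char_mul_neq1 chiP uw_neq0.
apply: (sum_add_char_eq0 chiP (L := form idfun A ^~ w) (w := b *: u)).
  by move=> v v'; rewrite formDl.
by rewrite formZl.
Qed.

Lemma sum_sqr_normc_add_char_form (I : finType) (f : I -> 'rV[F]_d) (W : {set I}) :
  \sum_v normc (\sum_(i in W) chi '[v, f i]) ^+ 2 = (q ^ d * #|collisions f W|)%:R.
Proof.
apply: (@complexI R); rewrite rmorph_sum rmorph_nat /=.
transitivity (\sum_v \sum_(p in setX W W) chi '[v, f p.1 - f p.2]).
  apply: eq_bigr => v _; rewrite rmorphXn /=.
  rewrite normc_complex sqr_normc rmorph_sum big_distrlr -big_setX; apply: eq_bigr => p _.
  by rewrite /= (conjc_add_char chiP) -(add_charD chiP) formDr formNr.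
rewrite exchange_big (eq_bigr _ (fun p _ => sum_add_char_form (f p.1 - f p.2))).
rewrite -big_mkcondr sumr_const -mulrnA.
by congr (_ *+ (_ * _)); apply: eq_card => p; rewrite [in RHS]inE -subr_eq0.
Qed.

Lemma sum_normc_add_char_form_le (T : finType) (D : {set T}) (phi : T -> 'rV[F]_d) Y :
  {in D &, injective phi} ->
  \sum_(t in D) normc (\sum_(v in Y) chi '[phi t, v])
    <= Num.sqrt (#|D| * (q ^ d * #|Y|))%:R.
Proof.
move=> phi_inj; pose S u := normc (\sum_(v in Y) chi '[u, v]).
have S_ge0 u : 0 <= S u by exact: normc_ge0.
rewrite -[leLHS]ger0_norm; last by apply: sumr_ge0 => t _; exact: S_ge0.
rewrite -sqrtr_sqr ler_sqrt ?ler0n //.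
apply: le_trans (sqr_sum_le_card _ _) _; rewrite natrM ler_wpM2l ?ler0n //.
have Y_inj : {in Y &, injective id} by [].
rewrite -(card_collisions_inj Y_inj) -sum_sqr_normc_add_char_form.
rewrite -(big_imset (fun u => S u ^+ 2) phi_inj) /= [leRHS](bigID (mem (phi @: D))) /=.
by rewrite lerDl sumr_ge0 // => u _; rewrite sqr_ge0.
Qed.

Lemma card_ortho_pairs_le X Y (K : R) :
  \sum_(t | t != 0) \sum_(u in X) normc (\sum_(v in Y) chi '[t *: u, v]) <= K ->
  (q * #|ortho_pairs A X Y|)%:R <= (#|X| * #|Y|)%:R + K.
Proof.
move=> K_bound; rewrite -cardsX.
apply: le_trans (card_zeros_le chiP (setX X Y) (fun p => '[p.1, p.2])) _.
rewrite lerD2l; apply: le_trans K_bound; apply: ler_sum => t _.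
rewrite (big_setX _ _ _ (fun u v => chi (t * '[u, v]))).
under eq_bigr do under eq_bigr do rewrite -formZl.
exact: le_normc_sum.
Qed.

(* The sums over [t] and [u] merge into one over the distinct vectors [t *: u]. *)
Lemma card_ortho_pairs_secant_le X Y :
  distinct_directions X ->
  (q * #|ortho_pairs A X Y|)%:R
    <= (#|X| * #|Y|)%:R + Num.sqrt (q ^ d.+1 * (#|X| * #|Y|))%:R :> R.
Proof.
move=> scale_inj; apply: card_ortho_pairs_le.
under eq_bigl do rewrite -in_setC1.
rewrite -(big_setX _ _ _ (fun t u => normc (\sum_(v in Y) chi '[t *: u, v]))).
apply: le_trans (sum_normc_add_char_form_le Y scale_inj) _.
rewrite ler_sqrt ?ler0n // ler_nat cardsX expnS [leqRHS]mulnACA.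
by rewrite !leq_mul // max_card.
Qed.

(* Both sets being orthogonal to [z], the sum over [v] does not change when [u]
   is translated by a multiple of [z]. *)
Lemma card_ortho_pairs_hyperplane_le X Y z :
  '[z, z] != 0 -> {in X, forall u, '[u, z] = 0} -> {in Y, forall v, '[z, v] = 0} ->
  (q * #|ortho_pairs A X Y|)%:R
    <= (#|X| * #|Y|)%:R + Num.sqrt (q ^ d.+1 * (#|X| * #|Y|))%:R :> R.
Proof.
move=> zz_neq0 Xz zY; apply: card_ortho_pairs_le.
set K := Num.sqrt _.
have q_gt0 : 0 < q%:R :> R by rewrite ltr0n ltnW ?finNzRing_gt1.
have slice t : t != 0 ->
    q%:R * \sum_(u in X) normc (\sum_(v in Y) chi '[t *: u, v]) <= K.
  move=> t_neq0; pose phi (p : 'rV[F]_d * F) := t *: (p.1 + p.2 *: z).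
  have phi_inj : {in setX X setT &, injective phi}.
    move=> [u s] [v r] /setXP[uX _] /setXP[vX _] /(scalerI t_neq0) /= uv.
    have sr : s = r.
      have := congr1 (fun x => '[x, z]) uv.
      by rewrite !formDl !formZl (Xz u) ?(Xz v) // !add0r => /(mulIf zz_neq0).
    by move: uv; rewrite sr => /addIr ->.
  have -> : q%:R * \sum_(u in X) normc (\sum_(v in Y) chi '[t *: u, v])
      = \sum_(p in setX X setT) normc (\sum_(v in Y) chi '[phi p, v]).
    rewrite (big_setX _ _ _ (fun u s => normc (\sum_(v in Y) chi '[phi (u, s), v]))).
    rewrite mulr_sumr; apply: eq_bigr => u uX.
    rewrite mulr_natl -cardsT -sumr_const; apply: eq_bigr => s _.
    congr normc; apply: eq_bigr => v vY.
    by rewrite !formZl formDl formZl zY // mulr0 addr0.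
  apply: le_trans (sum_normc_add_char_form_le Y phi_inj) _.
  by rewrite cardsX cardsT [(#|X| * q)%N]mulnC mulnACA -expnS.
rewrite -(ler_pM2l q_gt0) mulr_sumr; apply: le_trans (ler_sum _ slice) _.
rewrite sumr_const -[leLHS]mulr_natl ler_wpM2r ?sqrtr_ge0 // ler_nat; exact: max_card.
Qed.

End CharacterSums.

(** * Additive energy of subsets of the sphere *)

Section AdditiveEnergy.
Variable V : finZmodType.
Implicit Types (E : {set V}) (z : V).

Definition add_energy E : nat :=
  #|collisions (fun p : V * V => p.1 + p.2) (setX E E)|.

Definition translate E z : {set V} := [set u | u + z \in E].

Lemma card_translate E z : #|translate E z| = #|E|.
Proof. by rewrite -(card_preimset E (addIr z)); apply: eq_card => u; rewrite !inE. Qed.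

End AdditiveEnergy.

Lemma natr2_neq0 (R : nzRingType) : 2%N \notin [pchar R] -> 2 != 0 :> R.
Proof. by rewrite inE. Qed.

Section SphereGeometry.
Variables (F : finFieldType) (d : nat) (A : 'M[F]_d) (j : F).
Hypotheses (char_odd : 2%N \notin [pchar F]) (Asym : A^T = A) (j_neq0 : j != 0).
Variable E : {set 'rV[F]_d}.
Hypothesis ES : E \subset qsphere A j.
Local Notation "''[' u , v ]" := (form idfun A u v).

Lemma form_sub_qsphere x : x \in E -> '[x, x] = j.
Proof. by move/(subsetP ES); rewrite mem_qsphere => /eqP. Qed.

Section BasePoint.
Variable z : 'rV[F]_d.
Hypothesis zE : z \in E.
Local Notation Ez := (translate E z).
Implicit Types u v : 'rV[F]_d.

Lemma form_translate u : u \in Ez -> '[u, u] = - (2 * '[u, z]).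
Proof.
rewrite inE => /form_sub_qsphere; rewrite form_sqrD // (form_sub_qsphere zE) => /eqP.
by rewrite -subr_eq0 addrK addr_eq0 => /eqP.
Qed.

Lemma translate_add_orthogonal u v : u \in Ez -> v \in Ez -> u + v \in Ez -> '[u, v] = 0.
Proof.
move=> /form_translate uu /form_translate vv /form_translate.
rewrite form_sqrD // formDl uu vv => uv; apply: (mulfI (natr2_neq0 char_odd)).
by rewrite mulr0 -(subrr (- (2 * ('[u, z] + '[v, z])))) -{1}uv; ring.
Qed.

(* A line through [z] that is not tangent to the sphere meets it only once more. *)
Lemma translate_nontangent_directions :
  distinct_directions [set u in Ez | '[u, z] != 0].
Proof.
move=> [s u] [t v] /setXP[/= _ /setIdP[uE uz_neq0]].
move=> /setXP[/= + /setIdP[vE vz_neq0]] su_tv; rewrite in_setC1 => t_neq0.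
have z_eq : s * '[u, z] = t * '[v, z] by rewrite -!formZl su_tv.
have sqr_eq : s * (s * '[u, z]) = t * (t * '[v, z]).
  have scale a b : - (2 * (a * (a * b))) = a * (a * - (2 * b)) :> F by ring.
  apply: (mulfI (natr2_neq0 char_odd)); apply: oppr_inj.
  rewrite !scale -!form_translate //.
  by have := congr1 (fun x => '[x, x]) su_tv; rewrite !formZl !formZr /=.
have st : s = t by move: sqr_eq; rewrite z_eq => /mulIf; apply; rewrite mulf_neq0.
by move: su_tv; rewrite st => /(scalerI t_neq0) ->.
Qed.

End BasePoint.

Lemma add_energy_le_ortho_pairs :
  (add_energy E <= \sum_(z in E) #|ortho_pairs A (translate E z) (translate E z)|)%N.
Proof.
under eq_bigr do rewrite -sum1_card.
rewrite pair_big_dep sum1_card /=.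
pose chord (p : ('rV[F]_d * 'rV[F]_d) * ('rV[F]_d * 'rV[F]_d)) :=
  (p.2.1, (p.1.1 - p.2.1, p.1.2 - p.2.1)).
rewrite /add_energy -(card_in_imset (f := chord)); last first.
  move=> [[x y] [z w]] [[x' y'] [z' w']]; rewrite !inE /= => /andP[_ /eqP sum_eq].
  move=> /andP[_ /eqP sum_eq'] [zz']; rewrite -zz' => /addIr xx' /addIr yy'.
  by move: sum_eq'; rewrite -zz' -xx' -yy' sum_eq => /addrI ->.
apply: subset_leq_card; apply/subsetP => _ /imsetP[[[x y] [z w]] + ->].
rewrite !inE /= => /andP[/andP[/andP[xE yE] /andP[zE wE]] /eqP xy_zw].
rewrite unfold_in /= zE !inE !subrK xE yE /=.
apply/eqP/(translate_add_orthogonal zE); rewrite inE ?subrK //.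
by rewrite addrAC subrK addrA xy_zw addrAC subrr add0r.
Qed.

Section EnergyByCharacterSums.
Variables (R : realType) (chi : F -> R[i]).
Hypotheses (Aunit : A \in unitmx) (chiP : nontriv_add_char chi).

Lemma card_ortho_pairs_translate_le z : z \in E ->
  (#|F| * #|ortho_pairs A (translate E z) (translate E z)|)%:R
    <= 3 * (#|E|%:R ^+ 2 + Num.sqrt (#|F| ^ d.+1)%:R * #|E|%:R) :> R.
Proof.
move=> zE; set Ez := translate E z; set bound := _ + _.
pose secant := [set u in Ez | '[u, z] != 0].
pose tangent := [set u in Ez | '[u, z] == 0].
have secantE : secant \subset Ez by apply/subsetP => u; rewrite inE => /andP[].
have tangentE : tangent \subset Ez by apply/subsetP => u; rewrite inE => /andP[].
have le_bound (X Y : {set 'rV[F]_d}) : X \subset Ez -> Y \subset Ez ->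
    (#|X| * #|Y|)%:R + Num.sqrt (#|F| ^ d.+1 * (#|X| * #|Y|))%:R <= bound.
  move=> XE YE; have XY : (#|X| * #|Y| <= #|E| ^ 2)%N.
    by rewrite -mulnn -(card_translate E z) leq_mul ?subset_leq_card.
  rewrite lerD //; first by rewrite -natrX ler_nat.
  rewrite -[X in _ * X]ger0_norm ?ler0n // -sqrtr_sqr -sqrtrM ?ler0n //.
  rewrite ler_sqrt ?mulr_ge0 ?ler0n ?sqr_ge0 // -natrX -natrM ler_nat.
  by rewrite leq_mul2l XY orbT.
have secant_le (Y : {set 'rV[F]_d}) : Y \subset Ez ->
    (#|F| * #|ortho_pairs A secant Y|)%:R <= bound.
  move=> YE; apply: le_trans (le_bound _ _ secantE YE).
  exact: (card_ortho_pairs_secant_le Aunit chiP Y (translate_nontangent_directions zE)).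
have tangent_le : (#|F| * #|ortho_pairs A tangent tangent|)%:R <= bound.
  apply: le_trans (le_bound _ _ tangentE tangentE).
  apply: (card_ortho_pairs_hyperplane_le Aunit chiP (z := z)).
  - by rewrite form_sub_qsphere.
  - by move=> u; rewrite inE => /andP[_ /eqP].
  - by move=> u; rewrite inE form_symmetric // => /andP[_ /eqP].
rewrite (card_ortho_pairsID A Ez Ez (fun u => '[u, z] == 0)) -/tangent -/secant.
rewrite (card_ortho_pairsC _ Ez Asym).
rewrite (card_ortho_pairsID A Ez tangent (fun u => '[u, z] == 0)) -/tangent -/secant.
rewrite !mulnDr !natrD; have := secant_le _ (subxx Ez); have := secant_le _ tangentE.
by move: tangent_le; lra.
Qed.

Lemma add_energy_qsphere_le :
  (#|F| * add_energy E)%:R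
    <= 3 * (#|E|%:R ^+ 3 + Num.sqrt (#|F| ^ d.+1)%:R * #|E|%:R ^+ 2) :> R.
Proof.
apply: (@le_trans _ _ (\sum_(z in E)
    #|F| * #|ortho_pairs A (translate E z) (translate E z)|)%:R).
  by rewrite ler_nat -big_distrr leq_mul2l add_energy_le_ortho_pairs orbT.
rewrite natr_sum; apply: le_trans (ler_sum _ card_ortho_pairs_translate_le) _.
by rewrite sumr_const -[leLHS]mulr_natl; lra.
Qed.

End EnergyByCharacterSums.

Section Plane.
Hypotheses (d_eq2 : d = 2%N) (Aunit : A \in unitmx).
Implicit Types u v w z : 'rV[F]_d.

Lemma translate_plane_anisotropic z v :
  z \in E -> v \in translate E z -> v != 0 -> '[v, v] != 0.
Proof.
move=> zE vEz v_neq0; apply/eqP => vv; have := form_translate zE vEz.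
rewrite vv => /eqP; rewrite eq_sym oppr_eq0 mulf_eq0 (negbTE (natr2_neq0 char_odd)) /=.
rewrite form_symmetric // => /eqP zv.
have [t z_tv] := plane_orthogonal_collinear d_eq2 Aunit v_neq0 v_neq0 vv zv.
have /eqP := form_sub_qsphere zE.
by rewrite z_tv formZl formZr vv !mulr0 eq_sym (negbTE j_neq0).
Qed.

Lemma translate_plane_orthogonal_inj z u v w : z \in E ->
  v \in translate E z -> w \in translate E z -> u != 0 -> v != 0 -> w != 0 ->
  '[v, u] = 0 -> '[w, u] = 0 -> v = w.
Proof.
move=> zE vEz wEz u_neq0 v_neq0 w_neq0 vu wu.
have [t w_tv] := plane_orthogonal_collinear d_eq2 Aunit u_neq0 v_neq0 vu wu.
have t_neq0 : t != 0 by apply: contraNneq w_neq0 => t0; rewrite w_tv t0 scale0r.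
have vv_neq0 := translate_plane_anisotropic zE vEz v_neq0.
have := form_translate zE wEz; rewrite w_tv !formZl formZr /= [2 * _]mulrCA -mulrN.
rewrite -(form_translate zE vEz) => /(mulfI t_neq0) tvv.
have t1 : t = 1 by apply: (mulIf vv_neq0); rewrite mul1r.
by rewrite t1 scale1r.
Qed.

Lemma card_ortho_pairs_plane_le z : z \in E ->
  (#|ortho_pairs A (translate E z) (translate E z)| <= 3 * #|E|)%N.
Proof.
move=> zE; set Ez := translate E z.
pose zero : {set 'rV[F]_d} := [set 0].
pose nonzero_pairs := [set p in ortho_pairs A Ez Ez | (p.1 != 0) && (p.2 != 0)].
have cover : ortho_pairs A Ez Ez \subset setX zero Ez :|: setX Ez zero :|: nonzero_pairs.
  apply/subsetP => -[u v]; rewrite !inE /= => /andP[/andP[-> ->] ->].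
  by case: (u == 0); case: (v == 0).
have nonzero_le : (#|nonzero_pairs| <= #|E|)%N.
  rewrite -(card_translate E z) -(card_in_imset (f := snd)).
    apply: subset_leq_card; apply/subsetP => _ /imsetP[[u v] /setIdP[+ _] ->].
    by case/setIdP => /setXP[].
  move=> [u v] [u' v'] /setIdP[/setIdP[/setXP[/= uE _] /eqP uv] /andP[/= u0 v0]].
  move=> /setIdP[/setIdP[/setXP[/= uE' _] /eqP uv'] /andP[/= u0' _]] /= vv'.
  rewrite -vv' in uv' *.
  by rewrite (translate_plane_orthogonal_inj zE uE uE' v0 u0 u0' uv uv').
apply: leq_trans (subset_leq_card cover) _.
apply: leq_trans (leq_card_setU _ _) _; rewrite mulSn addnC leq_add //.
apply: leq_trans (leq_card_setU _ _) _.
by rewrite !cardsX cards1 mul1n muln1 card_translate addnn mul2n.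
Qed.

Lemma add_energy_plane_le : (add_energy E <= 3 * #|E| ^ 2)%N.
Proof.
apply: leq_trans add_energy_le_ortho_pairs _.
rewrite -mulnn mulnA mulnC -sum_nat_const.
by apply: leq_sum => z zE; exact: card_ortho_pairs_plane_le.
Qed.

End Plane.
End SphereGeometry.

(** * Cardinality of the sphere *)

Section SphereCardinality.
Variables (F : finFieldType) (d : nat).
Implicit Types (z : 'rV[F]_d) (U : {set 'rV[F]_d}).

Lemma card_line_roots_le k z U (p : 'rV[F]_d -> {poly F}) :
  (forall u, p u != 0) -> (forall u, size (p u) <= k.+1)%N ->
  (forall u t, u + t *: z \in U -> root (p u) t) ->
  (#|F| * #|U| <= k * #|F| ^ d)%N.
Proof.
move=> p_neq0 size_p root_p.
have line_le u : (#|[set t | (u + t *: z \in U)%R]| <= k)%N.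
  rewrite cardE -ltnS; apply: leq_trans (size_p u).
  apply: max_poly_roots (p_neq0 u) _ (enum_uniq _).
  by apply/allP => t; rewrite mem_enum inE; exact: root_p.
have -> : (#|F| * #|U| = \sum_(u : 'rV[F]_d) #|[set t | (u + t *: z \in U)%R]|)%N.
  under [RHS]eq_bigr do rewrite -sum1dep_card big_mkcond /=.
  rewrite exchange_big -sum_nat_const; apply: eq_bigr => t _.
  by rewrite -sum1_card big_mkcond (reindex_inj (addIr (t *: z))).
rewrite mulnC -[(_ ^ d)%N](_ : #|'rV[F]_d| = _); last by rewrite card_mx mul1n.
by rewrite -sum_nat_const; apply: leq_sum => u _; exact: line_le.
Qed.

Variables (A : 'M[F]_d) (j : F) (z : 'rV[F]_d).
Hypotheses (Asym : A^T = A) (j_neq0 : j != 0) (zS : z \in qsphere A j).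
Local Notation "''[' u , v ]" := (form idfun A u v).
Local Notation S := (qsphere A j).

Let zz : '[z, z] = j.
Proof. by apply/eqP; rewrite -mem_qsphere. Qed.

Lemma card_qsphere_le : (#|F| * #|S| <= 2 * #|F| ^ d)%N.
Proof.
pose p u : {poly F} := Poly [:: '[u, u] - j; 2 * '[u, z]; j].
have size_p u : size (p u) = 3 by rewrite (@PolyK _ 0).
apply: (card_line_roots_le (z := z) (p := p)) => [u|u|u t].
- by rewrite -size_poly_eq0 size_p.
- by rewrite size_p.
rewrite mem_qsphere form_sqrDZ // zz => /eqP uS.
by rewrite /root horner_Poly /= -[X in _ - X]uS; apply/eqP; ring.
Qed.

Definition nonchords : {set 'rV[F]_d} :=
  [set u | ('[u, u] == 0) || ('[u, z] == 0)].

Lemma card_nonchords_le : (#|F| * #|nonchords| <= 3 * #|F| ^ d)%N.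
Proof.
pose p u : {poly F} := Poly [:: '[u, u]; 2 * '[u, z]; j] * Poly [:: '[u, z]; j].
have size_p u : size (p u) = 4.
  by rewrite size_mul -?size_poly_eq0 !(@PolyK _ 0).
apply: (card_line_roots_le (z := z) (p := p)) => [u|u|u t].
- by rewrite -size_poly_eq0 size_p.
- by rewrite size_p.
rewrite inE form_sqrDZ // formDl formZl zz rootM /root !horner_Poly /= => ut.
by apply/orP; case/orP: ut => /eqP ut; [left|right]; apply/eqP; rewrite -[RHS]ut; ring.
Qed.

Hypothesis char_odd : 2%N \notin [pchar F].

(* Outside [nonchords], every vector is proportional to a chord [x - z]. *)
Lemma card_setC_nonchords_le : (#|~: nonchords| <= #|F| * #|S|)%N.
Proof.
rewrite mulnC -[#|F|]cardsT -cardsX.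
apply: leq_trans (leq_imset_card (fun p => p.2 *: (p.1 - z)) _).
apply: subset_leq_card; apply/subsetP => u; rewrite !inE negb_or.
move=> /andP[uu_neq0 uz_neq0]; pose c := - (2 * '[u, z]) / '[u, u].
have c_neq0 : c != 0.
  by rewrite mulf_neq0 ?invr_eq0 // oppr_eq0 mulf_neq0 // natr2_neq0.
apply/imsetP; exists (z + c *: u, c^-1); last first.
  by rewrite /= addrAC subrr add0r scalerK.
rewrite in_setX in_setT andbT mem_qsphere form_sqrDZ // zz (form_symmetric Asym z u).
by rewrite /c /=; apply/eqP; field.
Qed.

Lemma card_qsphere_ge : (#|F| ^ d <= 4 * 3 ^ d * (#|F| * #|S|))%N.
Proof.
have [q_le3|q_gt3] := leqP #|F| 3.
  have S_gt0 : (0 < #|S|)%N by apply/card_gt0P; exists z.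
  have : (#|F| ^ d <= 3 ^ d)%N by case: (d) => // n; rewrite leq_exp2r.
  move=> /leq_trans -> //; rewrite (leq_trans (leq_pmull _ (isT : 0 < 4)%N)) //.
  by rewrite leq_pmulr // muln_gt0 ltnW ?finNzRing_gt1.
have : (#|F| ^ d <= 4 * (#|F| * #|S|))%N.
  have nonchords_le := leq_trans (leq_mul q_gt3 (leqnn #|nonchords|)) card_nonchords_le.
  have total : (#|F| ^ d = #|nonchords| + #|~: nonchords|)%N.
    by rewrite cardsC card_mx mul1n.
  rewrite total in nonchords_le *; apply: leq_trans (leq_mul (leqnn 4) card_setC_nonchords_le).
  by lia.
by move=> /leq_trans -> //; rewrite leq_mul2r leq_pmulr ?expn_gt0 // orbT.
Qed.

End SphereCardinality.

(** * Real powers *)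

Section RealPowers.
Variable R : realType.
Implicit Types a b c e g k n q r s x y : R.

Lemma powRD_gt0 a x y : 0 < a -> a `^ (x + y) = a `^ x * a `^ y.
Proof. by move=> a_gt0; rewrite powRD //; apply/implyP => _; rewrite gt_eqF. Qed.

Lemma powR_split a x r : 0 < r -> a `^ r = a `^ x * a `^ (r - x).
Proof. by move=> r_gt0; rewrite -powRD addrC subrK // gt_eqF. Qed.

Lemma powR_root a r : 0 <= a -> 0 < r -> (a `^ r) `^ r^-1 = a.
Proof. by move=> a_ge0 r_gt0; rewrite -powRrM divff ?gt_eqF // powRr1. Qed.

Lemma powR_le1D x r : 0 <= x -> 0 <= r <= 1 -> x `^ r <= 1 + x.
Proof.
move=> x_ge0 /andP[r_ge0 r_le1]; have [x_le1|x_gt1] := leP x 1.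
  apply: (@le_trans _ _ (1 `^ r)); last by rewrite powR1 lerDl.
  by apply: ge0_ler_powR; rewrite ?nnegrE.
by apply: le_trans (ler1_powR (ltW x_gt1) r_le1) _; rewrite lerDr.
Qed.

Lemma lp_norm_antitone (I : finType) (f : I -> R) r s : 0 < r -> r <= s ->
  (forall i, 0 <= f i) ->
  (\sum_i f i `^ s) `^ s^-1 <= (\sum_i f i `^ r) `^ r^-1.
Proof.
move=> r_gt0 rs f_ge0; have s_gt0 : 0 < s by exact: lt_le_trans rs.
have sum_ge0 t : 0 <= \sum_i f i `^ t by apply: sumr_ge0 => i _; exact: powR_ge0.
set N := (\sum_i f i `^ r) `^ r^-1.
have N_ge0 : 0 <= N by exact: powR_ge0.
have N_r : N `^ r = \sum_i f i `^ r by rewrite /N -powRrM mulVf ?gt_eqF // powRr1.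
have f_le i : f i <= N.
  rewrite -(powR_root (f_ge0 i) r_gt0).
  apply: ge0_ler_powR; rewrite ?nnegrE ?powR_ge0 ?invr_ge0 ?(ltW r_gt0) //.
  by rewrite (bigD1 i) //= lerDl; apply: sumr_ge0 => k _; exact: powR_ge0.
rewrite -[leRHS](powR_root N_ge0 s_gt0).
apply: ge0_ler_powR; rewrite ?nnegrE ?powR_ge0 ?invr_ge0 ?(ltW s_gt0) //.
rewrite (powR_split N r s_gt0) N_r mulr_suml; apply: ler_sum => i _.
rewrite (powR_split _ r s_gt0) ler_wpM2l ?powR_ge0 //.
by apply: ge0_ler_powR; rewrite ?nnegrE ?subr_ge0.
Qed.

Lemma sum_powR_le_sup (I : finType) (f : I -> R) (k : nat) r n :
  0 < r -> k%:R <= r -> (forall i, 0 <= f i <= n) ->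
  \sum_i f i `^ r <= n `^ (r - k%:R) * \sum_i f i ^+ k.
Proof.
move=> r_gt0 k_le f_bounds; rewrite mulr_sumr; apply: ler_sum => i _.
have /andP[f_ge0 f_le] := f_bounds i.
rewrite (powR_split _ k%:R r_gt0) powR_mulrn // mulrC ler_wpM2r ?exprn_ge0 //.
by apply: ge0_ler_powR; rewrite ?nnegrE ?subr_ge0 // (le_trans f_ge0).
Qed.

(* Optimising over [y] would give Hoelder's inequality for the moments. *)
Lemma sum_powR_interpolate (I : finType) (f : I -> R) (k l : nat) r y :
  (k < l)%N -> 0 < r -> k%:R <= r <= l%:R -> 0 < y -> (forall i, 0 <= f i) ->
  \sum_i f i `^ r
    <= y `^ ((r - k%:R) / (l%:R - k%:R)) * (\sum_i f i ^+ k + (\sum_i f i ^+ l) / y).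
Proof.
move=> kl r_gt0 /andP[k_le le_l] y_gt0 f_ge0; set t := _ / _.
have lk_gt0 : 0 < l%:R - k%:R :> R by rewrite subr_gt0 ltr_nat.
have t01 : 0 <= t <= 1.
  by rewrite /t divr_ge0 ?(ltW lk_gt0) ?subr_ge0 //= ler_pdivrMr // mul1r lerB.
rewrite mulr_suml -big_split /= mulr_sumr; apply: ler_sum => i _.
have ratio_ge0 : 0 <= f i ^+ (l - k) / y by rewrite divr_ge0 ?exprn_ge0 // ltW.
have -> : f i `^ r = f i ^+ k * (y `^ t * (f i ^+ (l - k) / y) `^ t).
  rewrite -powRM // ?(ltW y_gt0) // mulrCA divff ?gt_eqF // mulr1.
  rewrite (powR_split _ k%:R r_gt0) -!powR_mulrn // -powRrM; congr (_ * _ `^ _).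
  by rewrite natrB ?(ltnW kl) // mulrC divfK // gt_eqF.
rewrite mulrCA ler_wpM2l ?powR_ge0 //.
apply: le_trans (ler_wpM2l (exprn_ge0 k (f_ge0 i)) (powR_le1D ratio_ge0 t01)) _.
by rewrite mulrDr mulr1 mulrA -exprD subnKC // ltnW.
Qed.

Lemma powR_exponent_balance q n s c c' e g b k r t :
  1 <= q -> 0 < n -> 0 < c -> 0 < c' -> 0 < s ->
  n <= c * q `^ g -> q `^ k <= c' * s ->
  t <= b -> t <= r -> e + g * (b - t) <= k * (r - t) ->
  q `^ e * n `^ b <= c `^ (b - t) * c' `^ (r - t) * (n `^ t * s `^ (r - t)).
Proof.
move=> q_ge1 n_gt0 c_gt0 c'_gt0 s_gt0 n_le s_ge tb tr exps.
have q_gt0 : 0 < q by exact: lt_le_trans q_ge1.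
have [n_ge0 s_ge0] := (ltW n_gt0, ltW s_gt0).
have [c_ge0 c'_ge0] := (ltW c_gt0, ltW c'_gt0).
have n_pow : n `^ (b - t) <= c `^ (b - t) * q `^ (g * (b - t)).
  rewrite powRrM -powRM ?powR_ge0 //.
  by apply: ge0_ler_powR; rewrite ?nnegrE ?subr_ge0 ?mulr_ge0 ?powR_ge0.
have s_pow : q `^ (k * (r - t)) <= c' `^ (r - t) * s `^ (r - t).
  rewrite powRrM -powRM //.
  by apply: ge0_ler_powR; rewrite ?nnegrE ?subr_ge0 ?mulr_ge0 ?powR_ge0.
have -> : n `^ b = n `^ t * n `^ (b - t) by rewrite -powRD_gt0 // addrC subrK.
have -> : c `^ (b - t) * c' `^ (r - t) * (n `^ t * s `^ (r - t))
    = n `^ t * (c `^ (b - t) * (c' `^ (r - t) * s `^ (r - t))) by ring.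
rewrite mulrCA ler_wpM2l ?powR_ge0 //.
apply: le_trans (ler_wpM2l (powR_ge0 _ _) n_pow) _.
rewrite mulrCA ler_wpM2l ?powR_ge0 // -powRD_gt0 //.
by apply: le_trans s_pow; exact: ler_powR.
Qed.

End RealPowers.

(** * Moments and extension estimates *)

Section ExponentialSums.
Variables (R : realType) (F : finFieldType) (d : nat) (chi : F -> R[i]).
Hypothesis chiP : nontriv_add_char chi.
Variable E : {set 'rV[F]_d}.
Local Notation q := #|F|.
Local Notation n := #|E|%:R.

Definition expsum (m : 'rV[F]_d) : R[i] := \sum_(x in E) chi (- dotv x m).

Lemma opp_dotvE (x m : 'rV[F]_d) : - dotv x m = form idfun 1%:M m (- x).
Proof.
rewrite formNr form_idfunE mulmx1 mxE; congr (- _).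
by apply: eq_bigr => i _; rewrite mulrC [in RHS]mxE.
Qed.

Lemma normc_expsum_le m : normc (expsum m) <= n.
Proof.
apply: le_trans (le_normc_sum _ _ _) _; under eq_bigr do rewrite normc_add_char //.
by rewrite sumr_const.
Qed.

Lemma sum_sqr_normc_expsum : \sum_m normc (expsum m) ^+ 2 = (q ^ d * #|E|)%:R.
Proof.
have opp_inj : {in E &, injective (@GRing.opp 'rV[F]_d)} by move=> x y _ _ /oppr_inj.
rewrite -(card_collisions_inj opp_inj).
rewrite -(sum_sqr_normc_add_char_form (unitmx1 F d) chiP); apply: eq_bigr => m _.
by under [in RHS]eq_bigr do rewrite -opp_dotvE.
Qed.

Lemma sum_pow4_normc_expsum : \sum_m normc (expsum m) ^+ 4 = (q ^ d * add_energy E)%:R.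
Proof.
have -> : add_energy E = #|collisions (fun p => - (p.1 + p.2)) (setX E E)|.
  by apply: eq_card => p; rewrite !inE eqr_opp.
rewrite -(sum_sqr_normc_add_char_form (unitmx1 F d) chiP); apply: eq_bigr => m _.
rewrite (exprM _ 2 2) (expr2 (normc _)) -normcM; congr (normc _ ^+ 2).
rewrite big_distrlr -big_setX; apply: eq_bigr => p _.
by rewrite /= -(add_charD chiP) !opp_dotvE opprD formDr.
Qed.

Variables (A : 'M[F]_d) (j : F).
Hypotheses (ES : E \subset qsphere A j) (E_gt0 : (0 < #|E|)%N).
Local Notation S := (qsphere A j).
Local Notation s := #|S|%:R.

Lemma ext_hat_indC m : ext_hat chi S (indC E) m = s^-1 * expsum m.
Proof.
rewrite /ext_hat (big_setID E) /= (setIidPr ES) [X in _ + X]big1 ?addr0; last first.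
  by move=> x; rewrite inE /indC => /andP[/negPf -> _]; rewrite mulr0.
by congr (_ * _); apply: eq_bigr => x xE; rewrite /indC xE mulr1.
Qed.

Lemma norm_Lr_ext_hat r : norm_Lr_dm (ext_hat chi S (indC E)) r
  = (s^-1 `^ r * \sum_m normc (expsum m) `^ r) `^ r^-1.
Proof.
rewrite /norm_Lr_dm mulr_sumr; congr (_ `^ _); apply: eq_bigr => m _.
by rewrite ext_hat_indC normcM normcV normc_nat powRM ?invr_ge0 ?normc_ge0.
Qed.

Lemma norm_Lp_indR (p : R) : p != 0 -> norm_Lp_dsigma S (indR E) p = (n / s) `^ p^-1.
Proof.
move=> p_neq0; rewrite /norm_Lp_dsigma mulrC; congr ((_ / _) `^ _).
rewrite (big_setID E) /= (setIidPr ES) [X in _ + X]big1 ?addr0; last first.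
  by move=> x; rewrite inE /indR => /andP[/negPf -> _]; rewrite normr0 powR0.
by rewrite -sumr_const; apply: eq_bigr => x xE; rewrite /indR xE normr1 powR1.
Qed.

Lemma norm_ext_hat_le (C p r : R) : 0 <= C -> 0 < p -> 0 < r ->
  \sum_m normc (expsum m) `^ r <= C * (n `^ (r / p) * s `^ (r - r / p)) ->
  norm_Lr_dm (ext_hat chi S (indC E)) r <= C `^ r^-1 * norm_Lp_dsigma S (indR E) p.
Proof.
move=> C_ge0 p_gt0 r_gt0 moment; rewrite norm_Lr_ext_hat norm_Lp_indR ?gt_eqF //.
have s_gt0 : 0 < s :> R by rewrite ltr0n (leq_trans E_gt0) // subset_leq_card.
have -> : p^-1 = r / p * r^-1 by rewrite mulrAC divff ?mul1r // gt_eqF.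
rewrite (powRrM (n / s)) -powRM ?powR_ge0 //.
have moment_ge0 : 0 <= \sum_m normc (expsum m) `^ r.
  by apply: sumr_ge0 => m _; exact: powR_ge0.
apply: ge0_ler_powR; rewrite ?nnegrE ?invr_ge0 ?mulr_ge0 ?powR_ge0 ?(ltW r_gt0) //.
apply: le_trans (ler_wpM2l (powR_ge0 _ _) moment) _.
rewrite (powR_split _ (r / p) r_gt0) powRM ?invr_ge0 ?ler0n //.
have cancel : s^-1 `^ (r - r / p) * s `^ (r - r / p) = 1 :> R.
  by rewrite -powRM ?invr_ge0 ?ler0n // mulVf ?gt_eqF // powR1.
by rewrite -[leRHS]mulr1 -[X in _ <= _ * X]cancel; lra.
Qed.

End ExponentialSums.

Section ExtensionEstimates.
Variables (R : realType) (d : nat).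
Implicit Types b e g p r : R.
Local Notation D := (d%:R : R).

Definition extension_bound g p r : Prop :=
  forall c1 c2 : R, 0 < c1 -> 0 < c2 ->
  exists C : R, 0 < C /\
    forall (F : finFieldType), 2%N \notin [pchar F] ->
    forall (A : 'M[F]_d), A^T = A -> A \in unitmx ->
    forall j : F, j != 0 ->
    forall chi : F -> R[i], nontriv_add_char chi ->
    forall E : {set 'rV[F]_d}, E \subset qsphere A j ->
    c1 <= #|E|%:R <= c2 * (#|F|%:R) `^ g ->
    norm_Lr_dm (ext_hat chi (qsphere A j) (indC E)) r
      <= C * norm_Lp_dsigma (qsphere A j) (indR E) p.

Definition moment_bound g r e b : Prop :=
  forall c : R, 0 < c ->
  exists C : R, 0 < C /\
    forall (F : finFieldType), 2%N \notin [pchar F] ->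
    forall (A : 'M[F]_d), A^T = A -> A \in unitmx ->
    forall j : F, j != 0 ->
    forall chi : F -> R[i], nontriv_add_char chi ->
    forall E : {set 'rV[F]_d}, E \subset qsphere A j -> (0 < #|E|)%N ->
    #|E|%:R <= c * (#|F|%:R) `^ g ->
    \sum_m normc (expsum chi E m) `^ r <= C * (#|F|%:R `^ e * #|E|%:R `^ b).

Lemma card_field_gt1 (F : finFieldType) : 1 < #|F|%:R :> R.
Proof. by rewrite ltr1n finNzRing_gt1. Qed.

Lemma powR_card_dim (F : finFieldType) : #|F|%:R `^ D = (#|F| ^ d)%:R :> R.
Proof. by rewrite powR_mulrn ?ler0n // natrX. Qed.

Lemma powR_card_dimB1 (F : finFieldType) :
  #|F|%:R * #|F|%:R `^ (D - 1) = (#|F| ^ d)%:R :> R.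
Proof.
have q_gt0 : 0 < #|F|%:R :> R by exact: lt_trans (card_field_gt1 F).
by rewrite -powR_card_dim -{1}(powRr1 (ltW q_gt0)) -powRD_gt0 // addrC subrK.
Qed.

Lemma extension_bound_of_moment g r e b p : 0 < r -> 1 <= p -> r / p <= b ->
  e + g * (b - r / p) <= (D - 1) * (r - r / p) ->
  moment_bound g r e b -> extension_bound g p r.
Proof.
move=> r_gt0 p_ge1 rp_le_b exps moment c1 c2 c1_gt0 c2_gt0.
have p_gt0 : 0 < p by exact: lt_le_trans p_ge1.
have [C [C_gt0 C_bound]] := moment c2 c2_gt0.
pose c' : R := (4 * 3 ^ d)%:R.
have c'_gt0 : 0 < c' by rewrite ltr0n muln_gt0 expn_gt0.
pose C' := C * (c2 `^ (b - r / p) * c' `^ (r - r / p)).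
have C'_gt0 : 0 < C' by rewrite !mulr_gt0 ?powR_gt0.
exists (C' `^ r^-1); split; first exact: powR_gt0.
move=> F char_odd A Asym Aunit j j_neq0 chi chiP E ES /andP[E_ge E_le].
have E_gt0 : (0 < #|E|)%N by rewrite -(ltr0n R) (lt_le_trans c1_gt0).
have [z zE] := card_gt0P E_gt0; have zS := subsetP ES z zE.
have q_gt0 : 0 < #|F|%:R :> R by exact: lt_trans (card_field_gt1 F).
have S_ge : #|F|%:R `^ (D - 1) <= c' * #|qsphere A j|%:R.
  rewrite -(ler_pM2l q_gt0) powR_card_dimB1 mulrCA -!natrM ler_nat.
  exact: (card_qsphere_ge Asym j_neq0 zS char_odd).
apply: norm_ext_hat_le => //; first exact: ltW.
apply: le_trans (C_bound _ char_odd _ Asym Aunit _ j_neq0 _ chiP _ ES E_gt0 E_le) _.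
rewrite -mulrA ler_pM2l //.
apply: (powR_exponent_balance (g := g) (k := D - 1)) => //.
- exact/ltW/card_field_gt1.
- by rewrite ltr0n.
- by rewrite ltr0n; apply/card_gt0P; exists z.
- by rewrite ler_pdivrMr // ler_peMr // ltW.
Qed.

Lemma extension_bound_increasing g p r r' : 0 < r -> r <= r' ->
  extension_bound g p r -> extension_bound g p r'.
Proof.
move=> r_gt0 rr' ext c1 c2 c1_gt0 c2_gt0.
have [C [C_gt0 C_bound]] := ext c1 c2 c1_gt0 c2_gt0.
exists C; split=> // F char_odd A Asym Aunit j j_neq0 chi chiP E ES E_bounds.
apply: le_trans (C_bound _ char_odd _ Asym Aunit _ j_neq0 _ chiP _ ES E_bounds).
exact: lp_norm_antitone r_gt0 rr' (fun m => normc_ge0 _).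
Qed.

(* Every subset of the sphere has at most [2 * q ^ (d - 1)] elements. *)
Lemma extension_bound_all_sizes g p r :
  extension_bound (D - 1) p r -> extension_bound g p r.
Proof.
move=> ext c1 c2 c1_gt0 c2_gt0.
have [C [C_gt0 C_bound]] := ext c1 2 c1_gt0 (ltr0Sn R 1).
exists C; split=> // F char_odd A Asym Aunit j j_neq0 chi chiP E ES /andP[E_ge _].
apply: C_bound => //; rewrite E_ge /=.
have [z zE] : exists z, z \in E.
  by apply/card_gt0P; rewrite -(ltr0n R) (lt_le_trans c1_gt0).
have q_gt0 : 0 < #|F|%:R :> R by exact: lt_trans (card_field_gt1 F).
rewrite -(ler_pM2l q_gt0) mulrCA powR_card_dimB1 -!natrM ler_nat.
apply: leq_trans (card_qsphere_le Asym j_neq0 (subsetP ES z zE)).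
by rewrite leq_mul2l subset_leq_card ?orbT.
Qed.

Lemma moment_bound_of_second_moment g r : 2 <= r -> moment_bound g r D (r - 1).
Proof.
move=> r_ge2 c _; exists 1; split=> // F _ A _ _ j _ chi chiP E _ E_gt0 _.
have n_gt0 : 0 < #|E|%:R :> R by rewrite ltr0n.
apply: le_trans (sum_powR_le_sup (k := 2) (n := #|E|%:R) _ r_ge2 _) _; first by lra.
  by move=> m; rewrite normc_ge0 normc_expsum_le.
rewrite sum_sqr_normc_expsum // natrM powR_card_dim mul1r mulrCA.
rewrite -{2}[#|E|%:R]powRr1 ?(ltW n_gt0) // -powRD_gt0 //.
by rewrite (_ : r - 2%:R + 1 = r - 1) //; ring.
Qed.

Lemma add_energy_qsphere_powR_le (F : finFieldType) (A : 'M[F]_d) (j : F)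
    (chi : F -> R[i]) (E : {set 'rV[F]_d}) c :
  2%N \notin [pchar F] -> A^T = A -> A \in unitmx -> j != 0 ->
  nontriv_add_char chi -> E \subset qsphere A j ->
  #|E|%:R <= c * #|F|%:R `^ ((D + 1) / 2) ->
  (add_energy E)%:R <= 3 * (c + 1) * (#|F|%:R `^ ((D - 1) / 2) * #|E|%:R ^+ 2).
Proof.
move=> char_odd Asym Aunit j_neq0 chiP ES; set q : R := #|F|%:R; set h := (D - 1) / 2.
have q_gt0 : 0 < q by exact: lt_trans (card_field_gt1 F).
have q_split : q `^ ((D + 1) / 2) = q * q `^ h.
  rewrite -{2}(powRr1 (ltW q_gt0)) -powRD_gt0 //; congr (_ `^ _).
  by rewrite /h; field.
have sqrt_q : Num.sqrt (#|F| ^ d.+1)%:R = q * q `^ h.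
  rewrite -q_split natrX -powR12_sqrt ?exprn_ge0 // -powR_mulrn ?ler0n // -powRrM.
  by rewrite -natr1.
rewrite q_split => E_le; rewrite -(ler_pM2l q_gt0).
have := add_energy_qsphere_le char_odd Asym j_neq0 ES Aunit chiP.
rewrite sqrt_q natrM => /le_trans; apply.
have -> : q * (3 * (c + 1) * (q `^ h * #|E|%:R ^+ 2))
    = 3 * (c * (q * q `^ h) * #|E|%:R ^+ 2 + q * q `^ h * #|E|%:R ^+ 2) by ring.
by rewrite ler_wpM2l // lerD2r exprS ler_wpM2r ?sqr_ge0.
Qed.

Lemma moment_bound_of_sphere_energy r : 2 <= r <= 4 ->
  moment_bound ((D + 1) / 2) r (D + (r / 2 - 1) * ((D - 1) / 2)) (r / 2).
Proof.
move=> r_range c c_gt0; exists (4 + 3 * c); split; first by lra.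
move=> F char_odd A Asym Aunit j j_neq0 chi chiP E ES E_gt0 E_le.
have energy := add_energy_qsphere_powR_le char_odd Asym Aunit j_neq0 chiP ES E_le.
set q : R := #|F|%:R in energy *; set n : R := #|E|%:R in energy *.
set h := (D - 1) / 2 in energy *.
have n_gt0 : 0 < n by rewrite ltr0n.
have q_gt0 : 0 < q by exact: lt_trans (card_field_gt1 F).
have y_gt0 : 0 < q `^ h * n by rewrite mulr_gt0 ?powR_gt0.
have r_gt0 : 0 < r by lra.
have := sum_powR_interpolate (isT : (2 < 4)%N) r_gt0 r_range y_gt0
  (fun m => normc_ge0 (expsum chi E m)).
have -> : (r - 2%:R) / (4%:R - 2%:R) = r / 2 - 1 by field.
rewrite sum_sqr_normc_expsum // sum_pow4_normc_expsum // !natrM -powR_card_dim.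
move=> /le_trans; apply.
have n_pow : n `^ (r / 2) = n `^ (r / 2 - 1) * n.
  by rewrite -{3}(powRr1 (ltW n_gt0)) -powRD_gt0 // subrK.
have -> : q `^ (D + (r / 2 - 1) * h) * n `^ (r / 2)
    = (q `^ h * n) `^ (r / 2 - 1) * (q `^ D * n).
  rewrite powRM ?powR_ge0 ?(ltW n_gt0) // -powRrM (mulrC h) powRD_gt0 //.
  by rewrite n_pow; ring.
rewrite [leRHS]mulrCA ler_wpM2l ?powR_ge0 //.
have -> : (4 + 3 * c) * (q `^ D * n) = q `^ D * n + q `^ D * (3 * (c + 1) * n) by ring.
rewrite lerD2l -[leLHS]mulrA ler_wpM2l ?powR_ge0 // ler_pdivrMr //.
by apply: le_trans energy _; lra.
Qed.

Lemma extension_bound_small p r : (2 <= d)%N -> 1 <= p -> 2 <= r ->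
  D + 1 <= (D - 1) * (r * (1 - p^-1)) -> extension_bound ((D - 1) / 2) p r.
Proof.
move=> d_ge2 p_ge1 r_ge2 criterion; have D_ge2 : 2 <= D by rewrite ler_nat.
apply: extension_bound_of_moment (moment_bound_of_second_moment _ r_ge2) => //.
  by lra.
  have : 1 <= r * (1 - p^-1) by rewrite -(@ler_pM2l _ (D - 1)); lra.
  by rewrite mulrBr mulr1; lra.
by rewrite mulrBr mulr1 in criterion; lra.
Qed.

Lemma extension_bound_interpolated p r : 2 <= p -> 2 <= r <= 4 ->
  D + 1 <= (D - 3) * (r * (1 - p^-1)) + r -> extension_bound ((D + 1) / 2) p r.
Proof.
move=> p_ge2 r_range criterion; have [r_ge2 r_le4] := andP r_range.
apply: extension_bound_of_moment (moment_bound_of_sphere_energy r_range); first by lra.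
- by lra.
- have p_inv : p^-1 <= 2^-1 by rewrite lef_pV2 ?posrE; lra.
  by apply: ler_wpM2l; lra.
by rewrite mulrBr mulr1 in criterion; lra.
Qed.

End ExtensionEstimates.

Lemma moment_bound_of_plane_energy (R : realType) (g r : R) :
  4 <= r -> moment_bound 2 g r 2 (r - 2).
Proof.
move=> r_ge4 c _; exists 3; split=> //.
move=> F char_odd A Asym Aunit j j_neq0 chi chiP E ES E_gt0 _.
have n_gt0 : 0 < #|E|%:R :> R by rewrite ltr0n.
apply: le_trans (sum_powR_le_sup (k := 4) (n := #|E|%:R) _ r_ge4 _) _; first by lra.
  by move=> m; rewrite normc_ge0 normc_expsum_le.
rewrite sum_pow4_normc_expsum // natrM -powR_card_dim mulrCA [leRHS]mulrCA.
rewrite ler_wpM2l ?powR_ge0 //.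
have -> : r - 2 = (r - 4%:R) + 2%:R by ring.
rewrite (powRD_gt0 _ 2%:R) // [leRHS]mulrCA ler_wpM2l ?powR_ge0 // powR_mulrn ?ler0n //.
by rewrite -natrX -natrM ler_nat; exact: (add_energy_plane_le char_odd Asym j_neq0).
Qed.

Lemma extension_bound_plane (R : realType) (g p r : R) : 1 <= p -> 4 <= r ->
  2 <= r * (1 - p^-1) -> extension_bound 2 g p r.
Proof.
move=> p_ge1 r_ge4 criterion; apply: extension_bound_all_sizes.
apply: extension_bound_of_moment (moment_bound_of_plane_energy _ r_ge4) => //.
  by lra.
  by rewrite mulrBr mulr1 in criterion; lra.
by lra.
Qed.

Lemma conjugate_exponent_ge (R : realFieldType) (p r N Np Nr : R) :
  0 < Np -> 0 < Nr -> Np <= N ->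
  N / Np <= p -> N / Nr <= r -> 1 <= p /\ (N - Np) / Nr <= r * (1 - p^-1).
Proof.
move=> Np_gt0 Nr_gt0 Np_le p_ge r_ge.
have N_gt0 : 0 < N by exact: lt_le_trans Np_le.
have ratio_ge1 : 1 <= N / Np by rewrite ler_pdivlMr // mul1r.
have ratio_gt0 : 0 < N / Np by exact: divr_gt0.
have p_gt0 : 0 < p by exact: lt_le_trans p_ge.
split; first exact: le_trans p_ge.
have -> : (N - Np) / Nr = N / Nr * (1 - (N / Np)^-1).
  by field; rewrite !gt_eqF.
apply: ler_pM => //; first by rewrite divr_ge0 ?ltW.
  by rewrite subr_ge0 invf_le1.
by rewrite lerB // lef_pV2 ?posrE.
Qed.

Section EndpointExponents.
Variables (R : realFieldType) (D p0 p r : R).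

Lemma small_exponents : 2 <= p0 -> 2 <= D ->
  ((6 * D - 2) * p0 - 8 * D + 8) / ((3 * D - 5) * p0 - 4 * D + 12) <= p ->
  ((6 * D - 2) * p0 - 8 * D + 8) / ((3 * D - 3) * p0 - 4 * D + 4) <= r ->
  [/\ 1 <= p, 2 <= r & D + 1 <= (D - 1) * (r * (1 - p^-1))].
Proof.
move=> p0_ge2 D_ge2; set N := _ + 8; set Np := _ + 12; set Nr := _ + 4.
have prod_ge0 : 0 <= (D - 2) * (p0 - 2) by rewrite mulr_ge0 ?subr_ge0.
have Np_gt0 : 0 < Np by rewrite /Np; lra.
have Nr_gt0 : 0 < Nr by rewrite /Nr; lra.
have Np_le : Np <= N by rewrite /N /Np; lra.
have Nr_le : 2 * Nr <= N by rewrite /N /Nr; lra.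
move=> p_ge r_ge.
have [p_ge1 conj_ge] := conjugate_exponent_ge Np_gt0 Nr_gt0 Np_le p_ge r_ge.
split=> //; first by apply: le_trans r_ge; rewrite ler_pdivlMr.
have -> : D + 1 = (D - 1) * ((N - Np) / Nr).
  by rewrite /N /Np /Nr; field; rewrite -/Nr gt_eqF.
by rewrite ler_wpM2l // subr_ge0 (le_trans _ D_ge2) // ler1n.
Qed.

Lemma interpolated_exponents : 2 <= p0 -> 3 <= D ->
  0 < (3 * D - 9) * p0 - 4 * D + 20 -> 0 < (3 * D - 7) * p0 - 4 * D + 12 ->
  ((6 * D - 10) * p0 - 8 * D + 24) / ((3 * D - 9) * p0 - 4 * D + 20) <= p ->
  let r0 := ((6 * D - 10) * p0 - 8 * D + 24) / ((3 * D - 7) * p0 - 4 * D + 12) in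
  [/\ 2 <= p, 2 <= r0 <= 4 & D + 1 <= (D - 3) * (r0 * (1 - p^-1)) + r0].
Proof.
move=> p0_ge2 D_ge3; set N := _ + 24; set Np := _ + 20; set Nr := _ + 12.
move=> Np_gt0 Nr_gt0.
have prod_ge0 : 0 <= (D - 3) * (p0 - 2) by rewrite mulr_ge0 ?subr_ge0.
have Np_le : Np <= N by rewrite /N /Np; lra.
have Np_le2 : 2 * Np <= N by rewrite /N /Np; lra.
have Nr_le2 : 2 * Nr <= N by rewrite /N /Nr; lra.
have Nr_le4 : N <= 4 * Nr by rewrite /N /Nr; lra.
move=> p_ge r0.
have [_ conj_ge] := conjugate_exponent_ge Np_gt0 Nr_gt0 Np_le p_ge (lexx r0).
split.
- by apply: le_trans p_ge; rewrite ler_pdivlMr.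
- by rewrite ler_pdivlMr // ler_pdivrMr // Nr_le2.
have -> : D + 1 = (D - 3) * ((N - Np) / Nr) + r0.
  by rewrite /r0 /N /Np /Nr; field; rewrite -/Nr gt_eqF.
by rewrite lerD2r ler_wpM2l // subr_ge0.
Qed.

Lemma plane_exponents : 2 <= p0 -> D = 2 ->
  0 < (3 * D - 9) * p0 - 4 * D + 20 -> 0 < (3 * D - 7) * p0 - 4 * D + 12 ->
  ((6 * D - 10) * p0 - 8 * D + 24) / ((3 * D - 9) * p0 - 4 * D + 20) <= p ->
  ((6 * D - 10) * p0 - 8 * D + 24) / ((3 * D - 7) * p0 - 4 * D + 12) <= r ->
  [/\ 1 <= p, 4 <= r & 2 <= r * (1 - p^-1)].
Proof.
move=> p0_ge2 D_eq2; set N := _ + 24; set Np := _ + 20; set Nr := _ + 12.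
move=> Np_gt0 Nr_gt0 p_ge r_ge.
have NE : N = 2 * p0 + 8 by rewrite /N D_eq2; ring.
have NpE : Np = 3 * (4 - p0) by rewrite /Np D_eq2; ring.
have NrE : Nr = 4 - p0 by rewrite /Nr D_eq2; ring.
have Np_le : Np <= N by lra.
have [p_ge1 conj_ge] := conjugate_exponent_ge Np_gt0 Nr_gt0 Np_le p_ge r_ge.
split=> //.
- by apply: le_trans r_ge; rewrite ler_pdivlMr //; lra.
- by apply: le_trans conj_ge; rewrite ler_pdivlMr //; lra.
Qed.

End EndpointExponents.

Theorem theorem1p4 (R : realType) (d : nat) (p0 : R) :
  (2 <= d)%N -> 2 <= p0 ->
  (* (i) *)
  (forall p r : R,
     ((6 * d%:R - 2) * p0 - 8 * d%:R + 8) / ((3 * d%:R - 5) * p0 - 4 * d%:R + 12) <= p ->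
     ((6 * d%:R - 2) * p0 - 8 * d%:R + 8) / ((3 * d%:R - 3) * p0 - 4 * d%:R + 4) <= r ->
     forall c1 c2 : R, 0 < c1 -> 0 < c2 ->
     exists C : R, 0 < C /\
       forall (F : finFieldType), 2%N \notin [pchar F] ->
       forall (A : 'M[F]_d), A^T = A -> A \in unitmx ->
       forall j : F, j != 0 ->
       forall chi : F -> R[i], nontriv_add_char chi ->
       forall E : {set 'rV[F]_d}, E \subset qsphere A j ->
       c1 <= #|E|%:R <= c2 * (#|F|%:R) `^ ((d%:R - 1) / 2) ->
       norm_Lr_dm (ext_hat chi (qsphere A j) (indC E)) r
         <= C * norm_Lp_dsigma (qsphere A j) (indR E) p)
  /\
  (* (ii) *)
  (forall p r : R,
     0 < (3 * d%:R - 9) * p0 - 4 * d%:R + 20 ->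
     0 < (3 * d%:R - 7) * p0 - 4 * d%:R + 12 ->
     ((6 * d%:R - 10) * p0 - 8 * d%:R + 24) / ((3 * d%:R - 9) * p0 - 4 * d%:R + 20) <= p ->
     ((6 * d%:R - 10) * p0 - 8 * d%:R + 24) / ((3 * d%:R - 7) * p0 - 4 * d%:R + 12) <= r ->
     forall c1 c2 : R, 0 < c1 -> 0 < c2 ->
     exists C : R, 0 < C /\
       forall (F : finFieldType), 2%N \notin [pchar F] ->
       forall (A : 'M[F]_d), A^T = A -> A \in unitmx ->
       forall j : F, j != 0 ->
       forall chi : F -> R[i], nontriv_add_char chi ->
       forall E : {set 'rV[F]_d}, E \subset qsphere A j ->
       c1 <= #|E|%:R <= c2 * (#|F|%:R) `^ ((d%:R + 1) / 2) ->
       norm_Lr_dm (ext_hat chi (qsphere A j) (indC E)) r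
         <= C * norm_Lp_dsigma (qsphere A j) (indR E) p).
Proof.
move=> d_ge2 p0_ge2; split=> [p r p_ge r_ge|p r Np_gt0 Nr_gt0 p_ge r_ge].
  have D_ge2 : 2 <= d%:R :> R by rewrite ler_nat.
  have [p_ge1 r_ge2 criterion] := small_exponents p0_ge2 D_ge2 p_ge r_ge.
  exact: extension_bound_small.
have [d_ge3|d_lt3] := leqP 3 d.
  have D_ge3 : 3 <= d%:R :> R by rewrite ler_nat.
  have [p_ge2 r0_range criterion] :=
    interpolated_exponents p0_ge2 D_ge3 Np_gt0 Nr_gt0 p_ge.
  apply: (extension_bound_increasing _ r_ge); first by lra.
  exact: extension_bound_interpolated.
have d_eq2 : d = 2%N by apply/eqP; rewrite eqn_leq d_ge2 -ltnS d_lt3.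
have D_eq2 : d%:R = 2 :> R by rewrite d_eq2.
have [p_ge1 r_ge4 criterion] := plane_exponents p0_ge2 D_eq2 Np_gt0 Nr_gt0 p_ge r_ge.
by rewrite d_eq2; exact: extension_bound_plane.
Qed.
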